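(* Compare the decentralized optimization method DADAO with the methods MSDA, ADOM+, OGT, AGT and the continuized framework, starting from the same Laplacians, in terms of the communication rates (orders of the total number of edges activated) and computation rates (orders of the total number of gradients computed) to reach precision $\epsilon$ that are listed in the context. Then: (1) If $\kappa=\mathcal{O}\big(\frac{|\bar{\mathcal{E}}|}{n}\big)$, then DADAO obtains a better communication rate than MSDA, and requires strictly less communications for the complete graph. (2) For any fixed Laplacian valid for ADOM+, DADAO obtains a better communication rate than ADOM+, and requires strictly less communications for the complete graph. (3) If $\kappa=\mathcal{O}\big(\frac{|\bar{\mathcal{E}}|}{n}\big)$, then, for a valid Laplacian using the gossip matrix of OGT or AGT, DADAO obtains a better communication rate than both of these gradient tracking methods, and requires strictly less communications for the complete graph. (4) DADAO requires fewer gradient computations than the continuized framework, and has a strictly better computation rate for the cycle graph.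
   Context: Problem: minimize $\sum_{i=1}^n f_i(x)$ over $x\in\mathbb{R}^d$, where each $f_i$ is $\mu$-strongly convex and $L$-smooth and is held by one of the $n$ nodes of a connected network with edge set $\mathcal{E}$ (ordered pairs); $\bar{\mathcal{E}}$ is the corresponding set of undirected edges. A Laplacian of the network is $\mathcal{L}=\sum_{(i,j)\in\mathcal{E}}\lambda_{ij}(e_i-e_j)(e_i-e_j)^{\mathsf T}$ with weights $0<\lambda_{ij}<\infty$ for $(i,j)\in\mathcal{E}$ (and $\lambda_{ij}=0$ for $(i,j)\notin\mathcal{E}$), $(e_i)$ being the canonical basis of $\mathbb{R}^n$. For such $\mathcal{L}$, $$\chi_1[\mathcal{L}]=\sup_{\|x\|=1,\,x\perp\mathbf{1}}\frac1{x^{\mathsf T}\mathcal{L}x},\qquad \chi_2[\mathcal{L}]=\frac12\sup_{(i,j)\in\mathcal{E}}(e_i-e_j)^{\mathsf T}\mathcal{L}^+(e_i-e_j),$$ $$\rho=\rho[\mathcal{L}]=\|\mathcal{L}\|\,\chi_1[\mathcal{L}],\qquad \kappa=\frac{\sup_{(i,j)\in\mathcal{E}}(\lambda_{ij}+\lambda_{ji})}{\inf_{(i,j)\in\mathcal{E}}(\lambda_{ij}+\lambda_{ji})},$$ where $\mathcal{L}^+$ is the pseudo-inverse, $\|\mathcal{L}\|$ the operator norm and $\mathbf{1}$ the all-ones vector. Methods, admissible gossip matrices, and complexities to reach precision $\epsilon$: - DADAO: an asynchronous method in which each node computes gradients at the times of a Poisson process of rate 1 and each edge $(i,j)$ communicates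 at the times of a Poisson process of rate given by its weight in a Laplacian $\Lambda$ that must satisfy $2\chi_1[\Lambda]\chi_2[\Lambda]\le1$. Given a Laplacian $\mathcal{L}$, it is run with $\Lambda=\sqrt{2\chi_1[\mathcal{L}]\chi_2[\mathcal{L}]}\,\mathcal{L}$, for a time $\mathcal{O}(\sqrt{L/\mu}\log\frac1\epsilon)$. Gradients: $\mathcal{O}(n\sqrt{L/\mu}\log\frac1\epsilon)$. Communications: $\frac12\sqrt{2\chi_1[\mathcal{L}]\chi_2[\mathcal{L}]}\;\mathrm{Tr}\,\mathcal{L}$ per unit of time. - MSDA: any Laplacian $\mathcal{L}$. Gradients: $\mathcal{O}(n\sqrt{L/\mu}\log\frac1\epsilon)$. Communications: $\mathcal{O}(|\mathcal{E}|\sqrt{\rho}\sqrt{L/\mu}\log\frac1\epsilon)$. - ADOM+: Laplacians $\mathcal{L}$ with $\|\mathcal{L}x-x\|^2\le(1-\frac1\chi)\|x\|^2$ for all $x\perp\mathbf{1}$, for some $\chi\ge1$. Gradients: $\mathcal{O}(n\sqrt{L/\mu}\log\frac1\epsilon)$. Communications: $\mathcal{O}(|\mathcal{E}|\chi\sqrt{L/\mu}\log\frac1\epsilon)$. - OGT and AGT (gradient tracking): $\mathcal{L}=\mathbf{I}-W$ with $W$ symmetric and doubly stochastic. Gradients: $\mathcal{O}(n\sqrt{L/\mu}\log\frac1\epsilon)$. Communications: $\mathcal{O}(|\mathcal{E}|\frac1{\sqrt\vartheta}\sqrt{L/\mu}\log\frac1\epsilon)$ with $\vartheta=1-\|W-\frac1n\mathbf{1}\mathbf{1}^{\mathsf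 T}\|$. - Continuized framework: Laplacians $\mathcal{L}$ with $\mathrm{Tr}\,\mathcal{L}=2$. Gradients and communications: both $\mathcal{O}(\sqrt{\chi_1[\mathcal{L}]\chi_2[\mathcal{L}]}\sqrt{L/\mu}\log\frac1\epsilon)$. *)

(* Defs.v *)
From HB Require Import structures.
From mathcomp Require Import all_boot all_order all_algebra all_fingroup.
From mathcomp Require Import all_classical all_reals all_analysis.

Set Implicit Arguments.
Unset Strict Implicit.
Unset Printing Implicit Defensive.

Import Order.TTheory GRing.Theory Num.Theory.
Import numFieldNormedType.Exports.

Local Open Scope classical_set_scope.
Local Open Scope ring_scope.

Section LinearAlgebra.
Variable R : realType.

Definition dot n (x y : 'cV[R]_n) : R := (x^T *m y) 0 0.

(* The canonical norm of 'cV[R]_n in the library is the sup norm. *)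
Definition enorm n (x : 'cV[R]_n) : R := Num.sqrt (dot x x).

Definition opnorm n (A : 'M[R]_n) : R :=
  sup [set enorm (A *m x) | x in [set x : 'cV[R]_n | enorm x = 1]].

Definition basis_vec n (i : 'I_n) : 'cV[R]_n := delta_mx i 0.

Definition ones n : 'cV[R]_n := const_mx 1.

(* Moore-Penrose conditions; [pinvmx] of the library is only a generalized
   inverse (it satisfies the first one). *)
Definition is_pseudo_inverse m n (A : 'M[R]_(m, n)) (P : 'M[R]_(n, m)) : Prop :=
  [/\ A *m P *m A = A, P *m A *m P = P,
      (A *m P)^T = A *m P & (P *m A)^T = P *m A].

Definition pseudo_inverse m n (A : 'M[R]_(m, n)) : 'M[R]_(n, m) :=
  xget 0 [set P | is_pseudo_inverse A P].

Lemma is_pseudo_inverse_unique m n (A : 'M[R]_(m, n)) P Q :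
  is_pseudo_inverse A P -> is_pseudo_inverse A Q -> P = Q.
Proof.
move=> [APA PAP sAP sPA] [AQA QAQ sAQ sQA].
have AP_AQ : A *m P = A *m Q.
  by rewrite -sAP -{1}AQA -(mulmxA (A *m Q)) trmx_mul sAP sAQ mulmxA APA.
have PA_QA : P *m A = Q *m A.
  by rewrite -sPA -{1}AQA (mulmxA P) (mulmxA P) -(mulmxA (P *m A)) trmx_mul sPA
             sQA -mulmxA (mulmxA A) APA.
by rewrite -PAP PA_QA -mulmxA AP_AQ mulmxA QAQ.
Qed.

Lemma gram_unit m n (B : 'M[R]_(m, n)) : row_free B -> B *m B^T \in unitmx.
Proof.
move=> fB; rewrite -row_free_unit; apply: inj_row_free => v vBB.
suff vB : v *m B = 0 by apply: (row_free_inj fB); rewrite /= mul0mx.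
have : (v *m B) *m (v *m B)^T = 0.
  by rewrite trmx_mul mulmxA -(mulmxA v) vBB mul0mx.
move=> /matrixP/(_ 0 0); rewrite mxE [RHS]mxE => /eqP.
rewrite psumr_eq0 => [/allP z|j _]; last by rewrite [(_^T) _ _]mxE -expr2 sqr_ge0.
apply/matrixP => a j; rewrite (ord1 a) [RHS]mxE.
have /= := z j (mem_index_enum j).
by rewrite [(_^T) _ _]mxE -expr2 sqrf_eq0 => /eqP.
Qed.

Lemma pseudo_inverse_exists m n (A : 'M[R]_(m, n)) :
  exists P, is_pseudo_inverse A P.
Proof.
suff fact r (C : 'M[R]_(m, r)) (B : 'M[R]_(r, n)) :
    row_full C -> row_free B -> exists P, is_pseudo_inverse (C *m B) P.
  rewrite -(mulmx_base A).
  by apply: (fact _ (col_base A) (row_base A)); rewrite ?col_base_full ?row_base_free.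
move=> fC fB.
have uB : B *m B^T \in unitmx by rewrite gram_unit.
have uC : C^T *m C \in unitmx.
  by rewrite -{2}[C]trmxK gram_unit // /row_free mxrank_tr.
have sB : (invmx (B *m B^T))^T = invmx (B *m B^T).
  by rewrite trmx_inv trmx_mul trmxK.
have sC : (invmx (C^T *m C))^T = invmx (C^T *m C).
  by rewrite trmx_inv trmx_mul trmxK.
set X := invmx (B *m B^T) in sB *; set Y := invmx (C^T *m C) in sC *.
have BX : B *m (B^T *m X) = 1%:M by rewrite mulmxA mulmxV.
have YC : Y *m C^T *m C = 1%:M by rewrite -mulmxA mulVmx.
exists (B^T *m X *m (Y *m C^T)).
have AP : C *m B *m (B^T *m X *m (Y *m C^T)) = C *m (Y *m C^T).
  by rewrite -!mulmxA (mulmxA B) (mulmxA (B *m _)) -(mulmxA B) BX mul1mx.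
have PA : B^T *m X *m (Y *m C^T) *m (C *m B) = B^T *m X *m B.
  by rewrite -(mulmxA (B^T *m X)) (mulmxA (Y *m _)) YC mul1mx.
split; rewrite ?AP ?PA.
- by rewrite -mulmxA (mulmxA (Y *m _)) YC mul1mx.
- by rewrite -mulmxA (mulmxA B) BX mul1mx.
- by rewrite !trmx_mul trmxK sC !mulmxA.
- by rewrite !trmx_mul trmxK sB !mulmxA.
Qed.

Lemma pseudo_inverseP m n (A : 'M[R]_(m, n)) :
  is_pseudo_inverse A (pseudo_inverse A).
Proof.
by have [P PP] := pseudo_inverse_exists A; apply: (xgetPex 0); exists P.
Qed.

End LinearAlgebra.

Section Networks.
Variable R : realType.

Definition linked n (E : {set 'I_n * 'I_n}) : rel 'I_n :=
  fun i j => ((i, j) \in E) || ((j, i) \in E).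

Definition undirected n (E : {set 'I_n * 'I_n}) : {set {set 'I_n}} :=
  [set [set e.1; e.2]%SET | e in E]%SET.

(* A connected network with edge set [edges] (an edge may be listed in one or
   in both orientations), together with the weights of one of its Laplacians. *)
Record network := Network {
  nodes : nat;
  edges : {set 'I_nodes * 'I_nodes};
  weight : 'I_nodes -> 'I_nodes -> R;
  nodes_gt1 : (1 < nodes)%N;
  edges_irrefl : forall i, (i, i) \notin edges;
  edges_connected : forall i j, connect (linked edges) i j;
  weight_gt0 : forall i j, (i, j) \in edges -> 0 < weight i j;
  weight_eq0 : forall i j, (i, j) \notin edges -> weight i j = 0
}.

Definition laplacian (N : network) : 'M[R]_(nodes N) :=
  \sum_(e in edges N) weight e.1 e.2 *:
     ((basis_vec R e.1 - basis_vec R e.2) *m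
      (basis_vec R e.1 - basis_vec R e.2)^T).

Definition complete_graph (N : network) : Prop :=
  forall i j : 'I_(nodes N), i != j -> linked (edges N) i j.

Definition cycle_graph (N : network) : Prop :=
  (2 < nodes N)%N /\
  exists s : {perm 'I_(nodes N)}, forall i j,
    linked (edges N) i j = (s j == ordS (s i)) || (s i == ordS (s j)).

Definition chi1 n (A : 'M[R]_n) : R :=
  sup [set (dot x (A *m x))^-1 | x in
        [set x : 'cV[R]_n | enorm x = 1 /\ dot x (ones R n) = 0]].

Definition chi2 n (E : {set 'I_n * 'I_n}) (A : 'M[R]_n) : R :=
  2^-1 * sup [set dot (basis_vec R e.1 - basis_vec R e.2)
                    (pseudo_inverse A *m (basis_vec R e.1 - basis_vec R e.2))
             | e in [set e | e \in E]].

Definition rho n (A : 'M[R]_n) : R := opnorm A * chi1 A.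

Definition kappa (N : network) : R :=
  sup [set weight e.1 e.2 + weight e.2 e.1 | e in [set e | e \in edges N]] /
  inf [set weight e.1 e.2 + weight e.2 e.1 | e in [set e | e \in edges N]].

Definition nodesR (N : network) : R := (nodes N)%:R.
Definition edgesR (N : network) : R := #|edges N|%:R.
Definition undirectedR (N : network) : R := #|undirected (edges N)|%:R.

Definition adom_valid (N : network) (chi : R) : Prop :=
  1 <= chi /\
  forall x : 'cV[R]_(nodes N), dot x (ones R _) = 0 ->
    enorm (laplacian N *m x - x) ^+ 2 <= (1 - chi^-1) * enorm x ^+ 2.

Definition doubly_stochastic n (W : 'M[R]_n) : Prop :=
  [/\ forall i j, 0 <= W i j, forall i, \sum_j W i j = 1
    & forall j, \sum_i W i j = 1].

Definition vartheta n (W : 'M[R]_n) : R :=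
  1 - opnorm (W - n%:R^-1 *: (ones R n *m (ones R n)^T)).

(* The last condition is the one under which the rate in 1/sqrt(vartheta) is
   finite; [x / 0] is [0] here, so it has to be explicit. *)
Definition tracking_valid (N : network) (W : 'M[R]_(nodes N)) : Prop :=
  [/\ laplacian N = 1%:M - W, W^T = W, doubly_stochastic W & 0 < vartheta W].

Definition continuized_valid (N : network) : Prop := \tr (laplacian N) = 2.

Section Rates.
(* [L] and [mu] are the smoothness and strong convexity constants of the local
   functions, [eps] is the target precision. *)
Variables (L mu eps : R).

Definition iterations : R := Num.sqrt (L / mu) * ln eps^-1.

Definition dadao_gossip (N : network) : 'M[R]_(nodes N) :=
  Num.sqrt (2 * chi1 (laplacian N) * chi2 (edges N) (laplacian N)) *:
    laplacian N.

(* [2^-1 * \tr Lambda] is the sum of the weights of [Lambda], that is, the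
   number of edges activated per unit of time. *)
Definition dadao_communications (N : network) : R :=
  2^-1 * \tr (dadao_gossip N) * iterations.

Definition dadao_gradients (N : network) : R := nodesR N * iterations.

Definition msda_communications (N : network) : R :=
  edgesR N * Num.sqrt (rho (laplacian N)) * iterations.

Definition adom_communications (N : network) (chi : R) : R :=
  edgesR N * chi * iterations.

Definition tracking_communications (N : network) (W : 'M[R]_(nodes N)) : R :=
  edgesR N * (Num.sqrt (vartheta W))^-1 * iterations.

Definition continuized_gradients (N : network) : R :=
  Num.sqrt (chi1 (laplacian N) * chi2 (edges N) (laplacian N)) * iterations.

End Rates.
End Networks.

(* Main.v *)
(** The communication rate of DADAO is half the square root of
    [2 * chi1 * chi2] times the trace [T] of the Laplacian, where [2 * chi2] is
    the largest effective resistance of an edge.  A resistance is at most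
    [2 / w] when all symmetrized weights are at least [w], and at most
    [8 / (n * w)] in the complete graph; with [T <= 2 * |E| * kappa * w] this
    bounds [chi2 * T] by [2 * kappa * |E|], with a gain of a factor of order [n]
    in the complete graph.  The other factor [T] is at most [n] times the
    operator norm.  For ADOM+ the crude bounds [chi2 <= chi1 <= 2 * chi] and
    [T <= 2 * n] suffice.
    In the other direction, Foster's theorem gives [chi2 * T >= n - 1], and the
    Poincaré inequality tested on basis vectors gives [chi1 * T >= n - 1].
    Tested on all rotations of an arc of half length in the cycle it gives
    [chi1 * T >= n ^ 2 / 8], whatever the weights. *)

Require Import Defs.
From HB Require Import structures.
From mathcomp Require Import all_boot all_order all_algebra all_fingroup.
From mathcomp Require Import all_classical all_reals all_analysis.
From mathcomp Require Import ring lra zify.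

Set Implicit Arguments.
Unset Strict Implicit.
Unset Printing Implicit Defensive.

Import Order.TTheory GRing.Theory Num.Theory.
Import numFieldNormedType.Exports.

Local Open Scope classical_set_scope.
Local Open Scope ring_scope.

(** * The Euclidean inner product and the operator norm *)

Section Dot.
Variables (R : realType) (n : nat).
Implicit Types (x y z : 'cV[R]_n) (A : 'M[R]_n).

Lemma dotE x y : dot x y = \sum_i x i 0 * y i 0.
Proof. by rewrite /dot mxE; apply: eq_bigr => i _; rewrite mxE. Qed.

Lemma dotC x y : dot x y = dot y x.
Proof. by rewrite !dotE; apply: eq_bigr => i _; rewrite mulrC. Qed.

Lemma dotDr x y z : dot x (y + z) = dot x y + dot x z.
Proof. by rewrite /dot mulmxDr mxE. Qed.

Lemma dotNr x y : dot x (- y) = - dot x y.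
Proof. by rewrite /dot mulmxN mxE. Qed.

Lemma dotZr a x y : dot x (a *: y) = a * dot x y.
Proof. by rewrite /dot -scalemxAr mxE. Qed.

Lemma dotDl x y z : dot (x + y) z = dot x z + dot y z.
Proof. by rewrite dotC dotDr !(dotC z). Qed.

Lemma dotNl x y : dot (- x) y = - dot x y.
Proof. by rewrite dotC dotNr dotC. Qed.

Lemma dotZl a x y : dot (a *: x) y = a * dot x y.
Proof. by rewrite dotC dotZr dotC. Qed.

Lemma dot_mull A x y : dot (A *m x) y = dot x (A^T *m y).
Proof. by rewrite /dot trmx_mul mulmxA. Qed.

Lemma dot_ge0 x : 0 <= dot x x.
Proof. by rewrite dotE sumr_ge0 // => i _; rewrite -expr2 sqr_ge0. Qed.

Lemma dot_eq0 x : dot x x = 0 -> x = 0.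
Proof.
rewrite dotE => /eqP; rewrite psumr_eq0 => [/allP h|i _]; last first.
  by rewrite -expr2 sqr_ge0.
apply/matrixP => i j; rewrite (ord1 j) [RHS]mxE.
by have /= := h i (mem_index_enum i); rewrite -expr2 sqrf_eq0 => /eqP.
Qed.

Lemma coord_sqr_le_dot x i : x i 0 ^+ 2 <= dot x x.
Proof.
rewrite dotE (bigD1 i) //= -expr2 lerDl sumr_ge0 // => j _.
by rewrite -expr2 sqr_ge0.
Qed.

Lemma enorm_sqr x : enorm x ^+ 2 = dot x x.
Proof. by rewrite /enorm sqr_sqrtr // dot_ge0. Qed.

Lemma enorm_ge0 x : 0 <= enorm x.
Proof. exact: sqrtr_ge0. Qed.

Lemma enorm1P x : enorm x = 1 -> dot x x = 1.
Proof. by rewrite -enorm_sqr => ->; rewrite expr1n. Qed.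

Lemma dot_enorm1 x : dot x x = 1 -> enorm x = 1.
Proof. by rewrite /enorm => ->; rewrite sqrtr1. Qed.

(** Cauchy-Schwarz: the residual [y - dot x y *: x] has nonnegative squared norm, which equals
    [dot y y - dot x y ^+ 2]. *)
Lemma dot_le_enorm x y : enorm x = 1 -> dot x y <= enorm y.
Proof.
move=> /enorm1P x1; have := dot_ge0 (y - dot x y *: x).
rewrite !(dotDl, dotDr, dotNl, dotNr, dotZl, dotZr) x1 (dotC y x) => h.
apply: le_trans (ler_norm _) _.
rewrite -(ler_pXn2r (ltn0Sn 1)) ?nnegrE ?normr_ge0 ?enorm_ge0 //.
rewrite enorm_sqr real_normK ?num_real //; nra.
Qed.

Lemma normalized x : x != 0 -> {a : R | enorm (a *: x) = 1 & a ^+ 2 * dot x x = 1}.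
Proof.
move=> x0; have dx : dot x x != 0 by apply: contra_neq x0 => /dot_eq0.
exists (enorm x)^-1; last by rewrite exprVn enorm_sqr mulVf.
by apply: dot_enorm1; rewrite dotZl dotZr mulrA -expr2 exprVn enorm_sqr mulVf.
Qed.

(** Source of the finiteness of all suprema below. Each product of two coordinates is at most
    [dot x x] in absolute value; the summand 1 keeps the constant positive when [A] is zero. *)
Lemma quad_form_le A : {C : R | 0 < C & forall x, dot x (A *m x) <= C * dot x x}.
Proof.
exists (1 + \sum_i \sum_j `|A i j|) => [|x].
  by rewrite ltr_wpDr // sumr_ge0 // => i _; rewrite sumr_ge0.
rewrite mulrDl mul1r ler_wpDl ?dot_ge0 // {1}dotE mulr_suml ler_sum // => i _.
rewrite mxE mulr_sumr mulr_suml ler_sum // => j _.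
have hi := coord_sqr_le_dot x i; have hj := coord_sqr_le_dot x j.
have -> : x i 0 * (A i j * x j 0) = A i j * (x i 0 * x j 0) by ring.
apply: le_trans (ler_norm _) _; rewrite normrM ler_wpM2l // ler_norml.
by apply/andP; split; nra.
Qed.

Lemma enorm_mul_le_opnorm A x : enorm x = 1 -> enorm (A *m x) <= opnorm A.
Proof.
move=> x1; apply: ub_le_sup; last by exists x.
have [C C0 hC] := quad_form_le (A^T *m A).
(* A real whose square is at most [C] is itself at most [C + 1]. *)
exists (C + 1) => _ [y /= /enorm1P y1 <-].
have : enorm (A *m y) ^+ 2 <= C.
  by rewrite enorm_sqr dot_mull mulmxA (le_trans (hC y)) // y1 mulr1.
by have := enorm_ge0 (A *m y); nra.
Qed.

Lemma quad_form_le_opnorm A x : enorm x = 1 -> dot x (A *m x) <= opnorm A.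
Proof.
by move=> x1; rewrite (le_trans (dot_le_enorm _ x1)) // enorm_mul_le_opnorm.
Qed.

Lemma dot_ones x : dot x (ones R n) = \sum_i x i 0.
Proof. by rewrite dotE; apply: eq_bigr => i _; rewrite mxE mulr1. Qed.

Lemma dot_basis_vecl x i : dot (basis_vec R i) x = x i 0.
Proof.
rewrite dotE (bigD1 i) //= big1 => [|j /negPf ji]; rewrite mxE ?ji ?mul0r //.
by rewrite !eqxx mul1r addr0.
Qed.

Lemma enorm_basis_vec i : enorm (basis_vec R i : 'cV[R]_n) = 1.
Proof. by apply: dot_enorm1; rewrite dot_basis_vecl mxE !eqxx. Qed.

Lemma mxtrace_le_opnorm A : \tr A <= n%:R * opnorm A.
Proof.
rewrite mulr_natl -[X in _ *+ X]card_ord -sumr_const ler_sum // => i _.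
have := quad_form_le_opnorm A (enorm_basis_vec i).
by rewrite dot_basis_vecl -colE mxE.
Qed.

(** Orthogonal projection onto the complement of [ones]. *)
Definition center x : 'cV[R]_n := x - (n%:R^-1 * \sum_i x i 0) *: ones R n.

Hypothesis n_gt0 : (0 < n)%N.

Let nR_neq0 : n%:R != 0 :> R. Proof. by rewrite pnatr_eq0 -lt0n. Qed.

Lemma dot_ones_ones : dot (ones R n) (ones R n) = n%:R.
Proof.
rewrite dot_ones (eq_bigr (fun=> 1)) => [|i _]; last by rewrite mxE.
by rewrite sumr_const card_ord.
Qed.

Lemma dot_center_ones x : dot (center x) (ones R n) = 0.
Proof. by rewrite dotDl dotNl dotZl dot_ones_ones dot_ones; field. Qed.

Lemma dot_center x :
  dot (center x) (center x) = dot x x - n%:R^-1 * (\sum_i x i 0) ^+ 2.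
Proof.
rewrite {2}/center dotDr dotNr dotZr dot_center_ones mulr0 subr0.
by rewrite dotDl dotNl dotZl (dotC _ x) dot_ones; ring.
Qed.

End Dot.

(** * The Dirichlet form, the spectral gap and effective resistances *)

Section Laplacian.
Variables (R : realType) (N : network R).
Local Notation n := (nodes N).
Local Notation Lap := (laplacian N).
Local Notation P := (pseudo_inverse Lap).
Local Notation lam := (@weight R N).
Implicit Types (x y : 'cV[R]_n) (M : 'M[R]_n) (i j : 'I_n).

Lemma nodes_gt0 : (0 < n)%N. Proof. exact: ltn_trans (nodes_gt1 N). Qed.

Lemma nodesR_gt0 : 0 < n%:R :> R. Proof. by rewrite ltr0n nodes_gt0. Qed.

Lemma weight_ge0 i j : 0 <= lam i j.
Proof.
have [/(@weight_gt0 _ N)/ltW //|/(@weight_eq0 _ N)->//] := boolP ((i, j) \in edges N).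
Qed.

(** Weights vanish off the edge set; sums over all ordered pairs are easier to exchange and
    symmetrize. *)
Lemma sum_edges (g : 'I_n -> 'I_n -> R) :
  \sum_(e in edges N) lam e.1 e.2 * g e.1 e.2 = \sum_i \sum_j lam i j * g i j.
Proof.
rewrite pair_big /= big_mkcond; apply: eq_bigr => -[i j] _ /=.
by case: ifPn => // /(@weight_eq0 _ N)->; rewrite mul0r.
Qed.

Lemma laplacian_tr : Lap^T = Lap.
Proof.
rewrite /laplacian linear_sum; apply: eq_bigr => e _.
by rewrite linearZ /= trmx_mul trmxK.
Qed.

Lemma laplacian_bilin x y :
  dot x (Lap *m y) =
  \sum_i \sum_j lam i j * ((x i 0 - x j 0) * (y i 0 - y j 0)).
Proof.
rewrite -(sum_edges (fun i j => (x i 0 - x j 0) * (y i 0 - y j 0))).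
rewrite /dot mulmx_suml mulmx_sumr summxE; apply: eq_bigr => e _.
rewrite -scalemxAl -scalemxAr mxE; congr (_ * _).
rewrite -mulmxA (mulmxA x^T) [LHS]mxE big_ord1.
have d (z : 'cV[R]_n) :
    ((basis_vec R e.1 - basis_vec R e.2)^T *m z) 0 0 = z e.1 0 - z e.2 0.
  by rewrite -[LHS]/(dot _ z) dotDl dotNl !dot_basis_vecl.
by rewrite d -[(x^T *m _) 0 0]/(dot x _) dotC [dot _ x]d.
Qed.

Lemma laplacian_quad x :
  dot x (Lap *m x) = \sum_i \sum_j lam i j * (x i 0 - x j 0) ^+ 2.
Proof. by rewrite laplacian_bilin; do 2!apply: eq_bigr => ? _; rewrite expr2. Qed.

Lemma laplacian_quad_ge0 x : 0 <= dot x (Lap *m x).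
Proof.
rewrite laplacian_quad; do 2!apply: sumr_ge0 => ? _.
by rewrite mulr_ge0 ?sqr_ge0 ?weight_ge0.
Qed.

Lemma laplacian_ones : Lap *m ones R n = 0.
Proof.
apply: dot_eq0; rewrite laplacian_bilin; do 2!apply: big1 => ? _.
by rewrite ![ones _ _ _ _]mxE subrr !mulr0.
Qed.

Lemma laplacian_quad_shift x c :
  dot (x + c *: ones R n) (Lap *m (x + c *: ones R n)) = dot x (Lap *m x).
Proof.
rewrite !laplacian_quad; do 2!apply: eq_bigr => ? _.
by rewrite !mxE mulr1 opprD addrACA subrr addr0.
Qed.

Lemma laplacian_quad_center x :
  dot (center x) (Lap *m center x) = dot x (Lap *m x).
Proof. by rewrite /center -scaleNr laplacian_quad_shift. Qed.

Lemma laplacian_bilinC x y : dot x (Lap *m y) = dot y (Lap *m x).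
Proof. by rewrite dotC dot_mull laplacian_tr. Qed.

(** Zero energy kills every term of the Dirichlet form, so [x] agrees across each edge, and
    connectedness propagates the equality. *)
Lemma laplacian_ker x : Lap *m x = 0 -> forall i j, x i 0 = x j 0.
Proof.
move=> Lx0 i j.
have q0 : dot x (Lap *m x) = 0 by rewrite Lx0 /dot mulmx0 mxE.
have edge_eq a b : (a, b) \in edges N -> x a 0 = x b 0.
  move=> abE; move: q0; rewrite laplacian_quad pair_big /= => /eqP.
  rewrite psumr_eq0 => [/allP/(_ (a, b) (mem_index_enum _))/=|[c d] _]; last first.
    by rewrite mulr_ge0 ?sqr_ge0 ?weight_ge0.
  rewrite mulf_eq0 sqrf_eq0 subr_eq0 => /orP[/eqP l0|/eqP//].
  by have := weight_gt0 abE; rewrite l0 ltxx.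
have /connectP[p pp ->] := @edges_connected _ N i j.
elim: p i pp => //= k p IH i /andP[ik /IH <-].
by case/orP: ik => /edge_eq.
Qed.

(** The columns of [1%:M - M] lie in the kernel of the Laplacian, hence are constant; by symmetry
    all entries coincide, and the row sums, equal to 1, fix their value. *)
Lemma laplacian_proj M :
  M^T = M -> Lap *m M = Lap -> M *m ones R n = 0 ->
  M = 1%:M - n%:R^-1 *: const_mx 1.
Proof.
move=> sM LM M1.
have D_col i i' j : (1%:M - M) i j = (1%:M - M) i' j.
  have := @laplacian_ker (col j (1%:M - M)) _ i i'; rewrite !mxE; apply.
  by rewrite colE mulmxA mulmxBr mulmx1 LM subrr mul0mx.
have D_sym i j : (1%:M - M) i j = (1%:M - M) j i.
  by rewrite -{1}sM -{1}trmx1 -linearB mxE.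
have D_row i : \sum_j (1%:M - M) i j = 1.
  transitivity (((1%:M - M) *m ones R n) i 0); last first.
    by rewrite mulmxBl mul1mx M1 subr0 mxE.
  by rewrite [RHS]mxE; apply: eq_bigr => j _; rewrite [ones _ _ _ _]mxE mulr1.
apply/matrixP => i j.
suff : (1%:M - M) i j = n%:R^-1 by rewrite !mxE => <-; ring.
have := D_row i; rewrite (eq_bigr (fun=> (1%:M - M) i j)) => [|k _].
  have n0 : n%:R != 0 :> R by rewrite gt_eqF // nodesR_gt0.
  by rewrite sumr_const card_ord => h; apply: (mulIf n0); rewrite mulr_natr h mulVf.
by rewrite (D_sym i k) (D_col k j) (D_sym j i).
Qed.

Lemma laplacian_pinv : Lap *m P = 1%:M - n%:R^-1 *: const_mx 1.
Proof.
have [LPL _ sLP _] := pseudo_inverseP Lap; apply: laplacian_proj => //.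
  by have := congr1 trmx LPL; rewrite trmx_mul sLP laplacian_tr.
by rewrite -sLP trmx_mul laplacian_tr -mulmxA laplacian_ones mulmx0.
Qed.

Lemma laplacian_pinv_mul x : dot x (ones R n) = 0 -> Lap *m (P *m x) = x.
Proof.
move=> x1; rewrite mulmxA laplacian_pinv mulmxBl mul1mx -scalemxAl.
suff -> : (const_mx 1 : 'M[R]_n) *m x = 0 by rewrite scaler0 subr0.
apply/matrixP => i j; rewrite (ord1 j) [LHS]mxE [RHS]mxE -[RHS]x1 dot_ones.
by apply: eq_bigr => k _; rewrite mxE mul1r.
Qed.

(* With y the solution of Lap y = x, expand the nonnegative energy of x - y / C
   where C bounds the quadratic form of the pseudo-inverse. *)
Lemma spectral_gap :
  exists2 C : R, 0 < C &
    forall x, dot x (ones R n) = 0 -> dot x x <= C * dot x (Lap *m x).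
Proof.
have [C C0 hC] := quad_form_le P; exists C => // x x1.
have Ly := laplacian_pinv_mul x1.
set y := P *m x in Ly.
have qy : dot y (Lap *m y) <= C * dot x x by rewrite Ly dotC hC.
have := laplacian_quad_ge0 (x - C^-1 *: y).
rewrite mulmxDr mulmxN -scalemxAr !(dotDl, dotDr, dotNl, dotNr, dotZl, dotZr).
rewrite (laplacian_bilinC y x) Ly.
have -> : dot x (Lap *m x) - C^-1 * dot x x +
     (- (C^-1 * dot x x) - - (C^-1 * (C^-1 * dot y x))) =
     dot x (Lap *m x) - C^-1 * (2 * dot x x - C^-1 * dot y x) by ring.
have : C^-1 * dot y x <= dot x x.
  by rewrite mulrC ler_pdivrMr // mulrC dotC hC.
rewrite subr_ge0 => h1; rewrite mulrC ler_pdivrMr // => h2.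
by rewrite mulrC; apply: le_trans h2; lra.
Qed.

(** [sup] takes a default value on unbounded sets; the spectral gap excludes this for [chi1]. *)
Lemma chi1_set_ub : has_ubound
  [set (dot x (Lap *m x))^-1 | x in
     [set x : 'cV[R]_n | enorm x = 1 /\ dot x (ones R n) = 0]].
Proof.
have [C C0 hC] := spectral_gap; exists C => _ [x /= [/enorm1P x1 /hC h] <-].
move: h; rewrite x1 => h.
have q0 : 0 < dot x (Lap *m x) by rewrite -(pmulr_rgt0 _ C0) (lt_le_trans ltr01).
by rewrite -[_^-1]mul1r ler_pdivrMr.
Qed.

Lemma chi1_poincare x : dot x (ones R n) = 0 ->
  dot x x <= chi1 Lap * dot x (Lap *m x).
Proof.
move=> x1; have [->|x0] := eqVneq x 0.
  by rewrite mulmx0 dotE big1 ?dotE ?big1 ?mulr0 // => i _; rewrite mxE mul0r.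
have [a ax1 a2] := normalized x0.
have ax_ones : dot (a *: x) (ones R n) = 0 by rewrite dotZl x1 mulr0.
have [C C0 /(_ _ ax_ones)] := spectral_gap.
rewrite (enorm1P ax1) => hC.
have q0 : 0 < dot (a *: x) (Lap *m (a *: x)).
  by rewrite -(pmulr_rgt0 _ C0) (lt_le_trans ltr01).
have : (dot (a *: x) (Lap *m (a *: x)))^-1 <= chi1 Lap.
  by apply: ub_le_sup; [exact: chi1_set_ub | exists (a *: x)].
rewrite -[_^-1]mul1r ler_pdivrMr // -scalemxAr dotZl dotZr mulrA -expr2.
rewrite mulrCA -{1}a2 ler_pM2l //.
by rewrite lt_def sqr_ge0 andbT; apply: contra_eq_neq a2 => ->;
   rewrite mul0r eq_sym oner_eq0.
Qed.

(** Poincaré inequality for [center x], multiplied by [n]: it can be tested on vectors that are not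
    orthogonal to [ones]. *)
Lemma variance_le_chi1 x :
  n%:R * dot x x - (\sum_i x i 0) ^+ 2 <= n%:R * chi1 Lap * dot x (Lap *m x).
Proof.
have := chi1_poincare (dot_center_ones nodes_gt0 x).
rewrite dot_center ?nodes_gt0 // laplacian_quad_center.
move=> /(ler_wpM2l (ltW nodesR_gt0)); rewrite mulrBr mulrA mulfV ?mul1r ?mulrA //.
by rewrite gt_eqF // nodesR_gt0.
Qed.

Definition edge_diff i j : 'cV[R]_n := basis_vec R i - basis_vec R j.

Lemma dot_edge_diff i j x : dot (edge_diff i j) x = x i 0 - x j 0.
Proof. by rewrite dotDl dotNl !dot_basis_vecl. Qed.

Lemma edge_diff_ones i j : dot (edge_diff i j) (ones R n) = 0.
Proof. by rewrite dot_edge_diff !mxE subrr. Qed.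

(** Makes the set defining [chi1] nonempty; this is where having two nodes matters. *)
Lemma exists_unit_orthogonal_ones :
  exists x : 'cV[R]_n, enorm x = 1 /\ dot x (ones R n) = 0.
Proof.
have [a [b ab]] : exists a, exists b : 'I_n, a != b.
  by exists (Ordinal nodes_gt0), (Ordinal (nodes_gt1 N)).
have d0 : edge_diff a b != 0.
  apply/eqP => /matrixP/(_ a 0); rewrite !mxE !eqxx (negPf ab) subr0 => /eqP.
  by rewrite oner_eq0.
have [c c1 _] := normalized d0; exists (c *: edge_diff a b); split=> //.
by rewrite dotZl edge_diff_ones mulr0.
Qed.

Lemma chi1_le (c : R) : 0 < c ->
  (forall x, enorm x = 1 -> dot x (ones R n) = 0 -> c^-1 <= dot x (Lap *m x)) ->
  chi1 Lap <= c.
Proof.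
move=> c0 h; apply: ge_sup => [|_ [x /= [x1 x_ones] <-]].
  by have [x hx] := exists_unit_orthogonal_ones; exists (dot x (Lap *m x))^-1, x.
by rewrite -[c]invrK lef_pV2 ?h ?posrE ?invr_gt0 //
           (lt_le_trans _ (h _ x1 x_ones)) ?invr_gt0.
Qed.

Lemma chi1_gt0 : 0 < chi1 Lap.
Proof.
have [x [x1 x_ones]] := exists_unit_orthogonal_ones.
have := chi1_poincare x_ones; rewrite (enorm1P x1) => h.
rewrite ltNge; apply/negP => c0; have := laplacian_quad_ge0 x.
by move=> q0; have := mulr_le0_ge0 c0 q0; lra.
Qed.

(** Effective resistance for the conductances [lam i j + lam j i]. *)
Definition resistance i j := dot (edge_diff i j) (P *m edge_diff i j).

(** [y] is the potential of a unit current from [i] to [j]: the resistance is both its drop and its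
    energy. *)
Lemma resistance_potential i j :
  exists2 y : 'cV[R]_n, resistance i j = y i 0 - y j 0
    & resistance i j = dot y (Lap *m y).
Proof.
exists (P *m edge_diff i j); first by rewrite -dot_edge_diff.
by rewrite laplacian_pinv_mul ?edge_diff_ones // dotC.
Qed.

Lemma resistance_ge0 i j : 0 <= resistance i j.
Proof. by have [y _ ->] := resistance_potential i j; exact: laplacian_quad_ge0. Qed.

Definition sym_weight i j := lam i j + lam j i.

Lemma laplacian_quad_sym x :
  2 * dot x (Lap *m x) = \sum_i \sum_j sym_weight i j * (x i 0 - x j 0) ^+ 2.
Proof.
rewrite mulr2n mulrDl mul1r {2}laplacian_quad exchange_big /= laplacian_quad -big_split.
apply: eq_bigr => i _ /=; rewrite -big_split; apply: eq_bigr => j _ /=.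
by rewrite /sym_weight -(opprB (x i 0)) sqrrN -mulrDl.
Qed.

Lemma sym_weight_ge0 i j : 0 <= sym_weight i j.
Proof. by rewrite addr_ge0 ?weight_ge0. Qed.

(** Keeping one row and dropping the symmetric column loses a factor 2, harmless for orders of
    magnitude. *)
Lemma row_energy_le x i :
  \sum_j sym_weight i j * (x i 0 - x j 0) ^+ 2 <= 2 * dot x (Lap *m x).
Proof.
rewrite laplacian_quad_sym [leRHS](bigD1 i) //= lerDl; do 2!apply: sumr_ge0 => ? _.
by rewrite mulr_ge0 ?sqr_ge0 ?sym_weight_ge0.
Qed.

(** The potential has drop and energy [r], so its term at [(i, j)] alone gives
    [sym_weight i j * r ^+ 2 <= 2 * r]. *)
Lemma resistance_weight i j : sym_weight i j * resistance i j <= 2.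
Proof.
have [y r_diff r_quad] := resistance_potential i j.
have := row_energy_le y i; rewrite (bigD1 j) //= -r_diff -r_quad => h.
have : sym_weight i j * resistance i j ^+ 2 <= 2 * resistance i j.
  apply: le_trans h; rewrite lerDl; apply: sumr_ge0 => ? _.
  by rewrite mulr_ge0 ?sqr_ge0 ?sym_weight_ge0.
have := resistance_ge0 i j; rewrite le0r => /orP[/eqP->|r0 h2].
  by rewrite !mulr0 ler0n.
by move: h2; rewrite expr2 mulrA ler_pM2r.
Qed.

(* The potential drop between i and j is shared by the two edges of each of the
   n paths of length at most two joining them. *)
Lemma resistance_complete (w : R) i j :
  0 <= w -> (forall a b, a != b -> w <= sym_weight a b) ->
  n%:R * w * resistance i j <= 8.
Proof.
move=> w0 hw; have [y r_diff r_quad] := resistance_potential i j.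
have row a : w * \sum_k (y a 0 - y k 0) ^+ 2 <= 2 * resistance i j.
  rewrite r_quad mulr_sumr (le_trans _ (row_energy_le y a)) // ler_sum // => k _.
  have [->|ak] := eqVneq a k; first by rewrite subrr expr0n !mulr0.
  by rewrite ler_wpM2r ?sqr_ge0 ?hw.
have : n%:R * resistance i j ^+ 2 <=
    2 * (\sum_k (y i 0 - y k 0) ^+ 2 + \sum_k (y j 0 - y k 0) ^+ 2).
  rewrite -big_split mulr_sumr mulr_natl -[X in _ *+ X]card_ord -sumr_const.
  apply: ler_sum => k _ /=; rewrite r_diff.
  by have := sqr_ge0 ((y i 0 - y k 0) + (y j 0 - y k 0)); nra.
move=> /(ler_wpM2l w0) h.
have := row i; have := row j; have := resistance_ge0 i j.
rewrite le0r => /orP[/eqP->|r0 hj hi]; first by rewrite !mulr0 ler0n.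
by rewrite -(ler_pM2r r0); lra.
Qed.

(** For the centered potential, of drop and energy [r], Poincaré gives
    [r ^+ 2 <= 2 * dot y y <= 2 * chi1 * r]. *)
Lemma resistance_le_chi1 i j : resistance i j <= 2 * chi1 Lap.
Proof.
have [y r_diff r_quad] := resistance_potential i j.
have [->|ij] := eqVneq i j.
  rewrite /resistance /edge_diff subrr mulmx0 dotE big1 => [|k _].
    by rewrite mulr_ge0 // ltW // chi1_gt0.
  by rewrite mxE mul0r.
have := chi1_poincare (dot_center_ones nodes_gt0 y).
rewrite laplacian_quad_center -r_quad => h.
have : (center y i 0 - center y j 0) ^+ 2 <= 2 * dot (center y) (center y).
  have -> : dot (center y) (center y) = center y i 0 ^+ 2 + (center y j 0 ^+ 2 +
     \sum_(k | (k != i) && (k != j)) center y k 0 ^+ 2).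
    by rewrite dotE (bigD1 i) //= (bigD1 j) //= eq_sym.
  have : 0 <= \sum_(k | (k != i) && (k != j)) center y k 0 ^+ 2.
    by apply: sumr_ge0 => k _; rewrite sqr_ge0.
  by have := sqr_ge0 (center y i 0 + center y j 0); lra.
have -> : center y i 0 - center y j 0 = resistance i j.
  by rewrite r_diff !mxE; ring.
move=> h2; have := resistance_ge0 i j.
rewrite le0r => /orP[/eqP->|r0]; first by rewrite mulr_ge0 // ltW // chi1_gt0.
by rewrite -(ler_pM2r r0) -expr2 (le_trans h2) // -mulrA ler_pM2l.
Qed.

End Laplacian.

(** * Bounds on the trace, chi1, chi2 and kappa *)

Section GossipConstants.
Variables (R : realType) (N : network R).
Local Notation n := (nodes N).
Local Notation Lap := (laplacian N).
Local Notation P := (pseudo_inverse Lap).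
Local Notation lam := (@weight R N).
Local Notation T := (\tr Lap).
Local Notation "#E" := (edgesR N) (at level 0).
Implicit Types (x y : 'cV[R]_n) (M : 'M[R]_n) (i j : 'I_n).

(** Cyclicity of the trace on the rank-one terms. Taking [M] to be the identity gives the trace, the
    pseudo-inverse gives Foster's sum. *)
Lemma mxtrace_laplacian_mul M :
  \tr (Lap *m M) =
  \sum_(e in edges N) lam e.1 e.2 * dot (edge_diff e.1 e.2) (M *m edge_diff e.1 e.2).
Proof.
rewrite mulmx_suml linear_sum; apply: eq_bigr => e _ /=.
by rewrite -scalemxAl linearZ /= -mulmxA mxtrace_mulC /dot mulmxA -mulmxA trace_mx11.
Qed.

Lemma mxtrace_laplacian : T = 2 * \sum_(e in edges N) lam e.1 e.2.
Proof.
rewrite -[Lap]mulmx1 mxtrace_laplacian_mul mulr_sumr.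
apply: eq_bigr => -[i j] ijE /=.
have ij : i != j by apply: contraTneq ijE => ->; exact: edges_irrefl.
by rewrite mul1mx dot_edge_diff !mxE !eqxx (negPf ij) eq_sym (negPf ij) /=; ring.
Qed.

Lemma mxtrace_laplacian_ge0 : 0 <= T.
Proof.
by rewrite mxtrace_laplacian mulr_ge0 // sumr_ge0 // => e _; exact: weight_ge0.
Qed.

Lemma mxtrace_laplacian_quad : T = \sum_i dot (basis_vec R i) (Lap *m basis_vec R i).
Proof. by apply: eq_bigr => i _; rewrite dot_basis_vecl -colE mxE. Qed.

Lemma node_incident i : exists j, linked (edges N) i j.
Proof.
have [k ik] : exists k : 'I_n, k != i.
  have [->|] := eqVneq i (Ordinal (nodes_gt0 N)); last first.
    by exists (Ordinal (nodes_gt0 N)); rewrite eq_sym.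
  by exists (Ordinal (nodes_gt1 N)).
have /connectP[[|j p] /=] := @edges_connected _ N i k.
  by move=> _ ki; rewrite ki eqxx in ik.
by case/andP=> ij _ _; exists j.
Qed.

Lemma edges_nonempty : exists e, e \in edges N.
Proof.
by have [j /orP[] ijE] := node_incident (Ordinal (nodes_gt0 N)); eexists; exact: ijE.
Qed.

(** Connectedness makes every node an endpoint, and an edge has two endpoints. *)
Lemma nodes_le_edges : n%:R <= 2 * #E.
Proof.
rewrite /edgesR -natrM ler_nat mul2n -addnn.
have cover : ([set: 'I_n] \subset
    [set e.1 | e in edges N] :|: [set e.2 | e in edges N])%SET.
  apply/fintype.subsetP => i _; have [j /orP[] ijE] := node_incident i.
    by apply/finset.setUP; left; apply/finset.imsetP; exists (i, j).
  by apply/finset.setUP; right; apply/finset.imsetP; exists (j, i).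
have := subset_leq_card cover; rewrite cardsT card_ord => /leq_trans; apply.
by rewrite (leq_trans (leq_card_setU _ _)) // leq_add // leq_imset_card.
Qed.

(** The diagonal, the edges and their reversals cover all ordered pairs, so [n ^ 2 <= n + 2 * #E];
    and [n <= n ^ 2 / 2] as [n >= 2]. *)
Lemma edges_complete : complete_graph N -> n%:R ^+ 2 <= 4 * #E.
Proof.
move=> compl; rewrite /edgesR -natrX -natrM ler_nat.
pose swap (e : 'I_n * 'I_n) := (e.2, e.1).
pose diag := [set (i, i) | i in 'I_n]%SET.
have cover : ([set: 'I_n * 'I_n] \subset diag :|: (edges N :|: swap @: edges N))%SET.
  apply/fintype.subsetP => -[i j] _; have [->|/compl] := eqVneq i j.
    by apply/finset.setUP; left; apply/finset.imsetP; exists j.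
  case/orP=> ijE; apply/finset.setUP; right; apply/finset.setUP; first by left.
  by right; apply/finset.imsetP; exists (j, i).
have := subset_leq_card cover; rewrite cardsT card_prod card_ord => h1.
have h2 := leq_trans h1 (leq_card_setU _ _).
have h3 := leq_trans h2 (leq_add (leqnn _) (leq_card_setU _ _)).
have swap_le : (#|swap @: edges N| <= #|edges N|)%N by exact: leq_imset_card.
have diag_le : (#|diag| <= n)%N.
  by rewrite (leq_trans (leq_imset_card _ _)) ?card_ord.
have h4 : (n * n <= n + (#|edges N| + #|edges N|))%N.
  by rewrite (leq_trans h3) // leq_add // leq_add2l.
by have := nodes_gt1 N; nia.
Qed.

Lemma resistance_le_chi2 i j : (i, j) \in edges N ->
  resistance i j <= 2 * chi2 (edges N) Lap.
Proof.
move=> ijE; rewrite /chi2 mulrA mulfV ?mul1r ?pnatr_eq0 //.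
apply: ub_le_sup; last by exists (i, j).
by exists (2 * chi1 Lap) => _ [e _ <-]; exact: resistance_le_chi1.
Qed.

Lemma chi2_le (c : R) :
  (forall i j, (i, j) \in edges N -> resistance i j <= 2 * c) ->
  chi2 (edges N) Lap <= c.
Proof.
move=> h; rewrite /chi2 mulrC ler_pdivrMr // mulrC; apply: ge_sup.
  by have [e eE] := edges_nonempty; eexists; exists e.
by move=> _ [[i j] /= ijE <-]; exact: h.
Qed.

Lemma chi2_ge0 : 0 <= chi2 (edges N) Lap.
Proof.
have [[i j] ijE] := edges_nonempty.
by rewrite -(pmulr_rge0 _ (ltr0Sn R 1)) (le_trans (resistance_ge0 i j)) ?resistance_le_chi2.
Qed.

Lemma chi2_le_chi1 : chi2 (edges N) Lap <= chi1 Lap.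
Proof. by apply: chi2_le => i j _; exact: resistance_le_chi1. Qed.

(** [w] is the infimum in [kappa], positive because a finite nonempty edge set attains its minimum.
    Every later use of [kappa] goes through this sandwich. *)
Lemma kappaP : exists2 w : R, 0 < w & forall i j, linked (edges N) i j ->
  w <= sym_weight i j <= kappa N * w.
Proof.
set S := [set weight e.1 e.2 + weight e.2 e.1 | e in [set e | e \in edges N]].
have edgeS e : e \in edges N -> S (weight e.1 e.2 + weight e.2 e.1) by exists e.
have [e0 e0E] := edges_nonempty.
have S_lb : has_lbound S.
  by exists 0 => _ [e _ <-]; rewrite addr_ge0 ?weight_ge0.
have S_ub : has_ubound S.
  exists (\sum_i \sum_j sym_weight (N := N) i j) => _ [[i j] _ <-] /=.
  rewrite (bigD1 i) //= (bigD1 j) //= -addrA lerDl addr_ge0 ?sumr_ge0 // => *.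
    exact: sym_weight_ge0.
  by rewrite sumr_ge0 // => *; exact: sym_weight_ge0.
have inf_gt0 : 0 < inf S.
  case: (arg_minP (fun e : 'I_n * 'I_n => sym_weight (N := N) e.1 e.2) e0E) =>
    e eE e_min.
  apply: (@lt_le_trans _ _ (sym_weight e.1 e.2)).
    by rewrite ltr_wpDr ?weight_ge0 // weight_gt0 // -surjective_pairing.
  apply: lb_le_inf; first by exists (weight e.1 e.2 + weight e.2 e.1); exact: edgeS.
  by move=> _ [f fE <-]; exact: e_min.
exists (inf S) => // i j ij; rewrite /kappa -/S divfK ?gt_eqF //.
have Sij : S (sym_weight i j).
  case/orP: ij => /edgeS //=; by rewrite /sym_weight addrC.
by rewrite ge_inf // ub_le_sup.
Qed.

Lemma mxtrace_laplacian_le (w : R) :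
  (forall i j, linked (edges N) i j -> sym_weight i j <= w) -> T <= 2 * #E * w.
Proof.
move=> hw; rewrite mxtrace_laplacian -mulrA ler_pM2l // mulr_natl -sumr_const.
apply: ler_sum => -[i j] ijE /=.
by apply: le_trans (hw i j _); [rewrite lerDl weight_ge0 | rewrite /linked ijE].
Qed.

Lemma kappa_ge0 : 0 <= kappa N.
Proof.
have [w w0 hw] := kappaP.
have [j /hw/andP[h1 h2]] := node_incident (Ordinal (nodes_gt0 N)).
by rewrite -(pmulr_lge0 _ w0) (le_trans (ltW w0)) // (le_trans h1).
Qed.

Lemma edgesR_ge0 : 0 <= #E. Proof. exact: ler0n. Qed.

Lemma chi2_mxtrace_le : chi2 (edges N) Lap * T <= 2 * kappa N * #E.
Proof.
have [w w0 hw] := kappaP.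
have hT : T <= 2 * #E * (kappa N * w).
  by apply: mxtrace_laplacian_le => i j /hw/andP[].
have hchi2 : chi2 (edges N) Lap <= w^-1.
  apply: chi2_le => i j ijE; rewrite ler_pdivlMr //.
  have /andP[h _] : w <= sym_weight i j <= kappa N * w by rewrite hw // /linked ijE.
  by rewrite mulrC (le_trans _ (resistance_weight i j)) // ler_wpM2r // resistance_ge0.
rewrite (le_trans (ler_pM chi2_ge0 mxtrace_laplacian_ge0 hchi2 hT)) //.
rewrite le_eqVlt; apply/orP; left; apply/eqP; field; exact: lt0r_neq0.
Qed.

Lemma chi2_mxtrace_complete_le : complete_graph N ->
  chi2 (edges N) Lap * T * n%:R <= 8 * kappa N * #E.
Proof.
move=> compl; have [w w0 hw] := kappaP; have n0 := nodesR_gt0 N.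
have hT : T <= 2 * #E * (kappa N * w).
  by apply: mxtrace_laplacian_le => i j /hw/andP[].
(* Half of the resistance bound [8 / (n * w)]; the scale [w] then cancels against the trace. *)
have hchi2 : chi2 (edges N) Lap <= 4 / (n%:R * w).
  apply: chi2_le => i j ijE; rewrite mulrA ler_pdivlMr ?mulr_gt0 //.
  rewrite mulrC -natrM; apply: resistance_complete; first exact: ltW.
  by move=> a b /compl/hw/andP[].
rewrite (le_trans (ler_wpM2r (ltW n0) (ler_pM chi2_ge0 mxtrace_laplacian_ge0 hchi2 hT))) //.
rewrite le_eqVlt; apply/orP; left; apply/eqP; field.
by rewrite !lt0r_neq0.
Qed.

(* Foster's theorem: the resistances weighted by the conductances sum to n - 1. *)
Lemma chi2_mxtrace_ge : n%:R - 1 <= chi2 (edges N) Lap * T.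
Proof.
have n0 : n%:R != 0 :> R by rewrite gt_eqF // nodesR_gt0.
have <- : \tr (Lap *m P) = n%:R - 1.
  rewrite laplacian_pinv linearB linearZ /= mxtrace1; congr (_ - _).
  rewrite /mxtrace (eq_bigr (fun=> 1)) => [|i _]; last by rewrite mxE.
  by rewrite sumr_const card_ord mulVf.
rewrite mxtrace_laplacian_mul mxtrace_laplacian mulrA mulr_sumr.
apply: ler_sum => -[i j] ijE /=; rewrite mulrC ler_wpM2r ?weight_ge0 //.
by rewrite mulrC resistance_le_chi2.
Qed.

(** Each basis vector has variance term [n - 1], and the energies of the basis vectors add up to the
    trace. *)
Lemma chi1_mxtrace_ge : n%:R - 1 <= chi1 Lap * T.
Proof.
have n0 := nodesR_gt0 N.
rewrite -(ler_pM2l n0) mulrA mxtrace_laplacian_quad mulr_sumr mulr_natl.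
rewrite -[X in _ *+ X]card_ord -sumr_const; apply: ler_sum => i _.
apply: le_trans (variance_le_chi1 _).
rewrite (enorm1P (enorm_basis_vec R i)) mulr1 -dot_ones dot_basis_vecl mxE.
by rewrite expr1n.
Qed.

End GossipConstants.

(** * Rotated arcs in the cycle *)

Lemma sum_modn_shift n (c : nat) (g : nat -> nat) :
  (0 < n)%N -> (\sum_(t < n) g ((c + t) %% n) = \sum_(t < n) g t)%N.
Proof.
case: n => // n _; rewrite [RHS](reindex_inj (addrI (inZp c : 'I_n.+1))) /=.
by apply: eq_bigr => t _; rewrite modnDml.
Qed.

Lemma sum_ord_eq_le1 n (c : nat) : (\sum_(t < n) (t == c :> nat) <= 1)%N.
Proof.
have [cn|nc] := ltnP c n.
  by rewrite (bigD1 (Ordinal cn)) //= eqxx big1 // => t /negPf; rewrite -val_eqE /= => ->.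
by rewrite big1 // => t _; rewrite ltn_eqF // (leq_trans (ltn_ord t)).
Qed.

Lemma sum_ord_ltn n h : (h <= n)%N -> (\sum_(t < n) (t < h) = h)%N.
Proof.
move=> hn; rewrite -big_mkcond /= (big_ord_narrow hn) /=.
by rewrite sum1_card card_ord.
Qed.

(* An arc of length h in the cycle of length n has two boundary edges. *)
Lemma sum_arc_boundary n h c : (0 < n)%N ->
  (\sum_(t < n) (((c + t) %% n < h) (+) ((c.+1 %% n + t) %% n < h)) <= 2)%N.
Proof.
move=> n0; pose g u := nat_of_bool ((u < h) (+) (u.+1 %% n < h))%N.
rewrite (eq_bigr (fun t : 'I_n => g ((c + t) %% n)%N)) => [|t _]; last first.
  by rewrite /g modnDml addSn -[(_ %% n).+1]addn1 modnDml !addn1.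
rewrite (sum_modn_shift _ g) //.
(* The arc occupies positions 0 to [h - 1], so only the steps out of [h - 1] and [n - 1] can cross
   its boundary. For [h = 0] nothing crosses. *)
apply: (@leq_trans (\sum_(t < n) ((t == h.-1 :> nat) + (t == n.-1 :> nat)))%N).
  apply: leq_sum => t _; rewrite /g; have := ltn_ord t.
  have [tn|tn] := ltnP t.+1 n; last first.
    by move=> ?; case: (t =P n.-1 :> nat); [case: addb; rewrite addnC | lia].
  by rewrite modn_small // => _; lia.
by rewrite big_split (leq_add (sum_ord_eq_le1 _ _) (sum_ord_eq_le1 _ _)).
Qed.

Section Cycle.
Variables (R : realType) (N : network R).
Local Notation n := (nodes N).
Local Notation Lap := (laplacian N).

(* Sum the Poincaré inequality for the indicator of an arc of length h over its
   n rotations: every edge is cut by two of them. *)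
Lemma cycle_chi1_mxtrace_ge (h : nat) : cycle_graph N -> (h <= n)%N ->
  h%:R * (n%:R - h%:R) <= chi1 Lap * \tr Lap.
Proof.
case=> _ [s s_cycle] hn; have n0 := nodes_gt0 N; have nR0 := nodesR_gt0 N.
(* [s] numbers the nodes around the cycle; [t] rotates the arc. *)
pose inarc (t i : 'I_n) := ((s i + t) %% n < h)%N.
pose x t : 'cV[R]_n := \col_i (inarc t i)%:R.
have card_arc t : \sum_i x t i 0 = h%:R.
  rewrite (eq_bigr (fun i => (inarc t i)%:R)) => [|i _]; last by rewrite mxE.
  rewrite -natr_sum; congr (_%:R).
  rewrite (reindex_inj (@perm_inj _ s^-1%g)) /= /inarc.
  under eq_bigr do rewrite permKV addnC.
  by rewrite (sum_modn_shift _ (fun u => nat_of_bool (u < h)%N)) // sum_ord_ltn.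
have dot_arc t : dot (x t) (x t) = h%:R.
  rewrite -(card_arc t) dotE; apply: eq_bigr => i _; rewrite mxE.
  by case: (inarc _ _); rewrite ?mulr1 ?mulr0.
(* Each edge is cut by at most two rotations, and the trace is twice the total weight. *)
have energy : \sum_t dot (x t) (Lap *m x t) <= \tr Lap.
  under eq_bigr => t _ do
    rewrite laplacian_quad -(sum_edges (fun i j => (x t i 0 - x t j 0) ^+ 2)).
  rewrite exchange_big mxtrace_laplacian mulr_sumr; apply: ler_sum => -[i j] ijE /=.
  rewrite -mulr_sumr mulrC ler_wpM2r ?weight_ge0 //.
  rewrite (eq_bigr (fun t => (inarc t i (+) inarc t j)%:R)) => [|t _]; last first.
    by rewrite !mxE; do 2!case: (inarc _ _);
      rewrite /= ?subrr ?expr0n ?subr0 ?sub0r ?sqrrN ?expr1n.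
  rewrite -natr_sum ler_nat.
  have /orP[/eqP sji|/eqP sij] : (s j == ordS (s i)) || (s i == ordS (s j)).
    by rewrite -s_cycle /linked ijE.
  - by rewrite /inarc sji; exact: sum_arc_boundary.
  - under eq_bigr do rewrite addbC.
    by rewrite /inarc sij; exact: sum_arc_boundary.
have : n%:R * (n%:R * h%:R - h%:R ^+ 2) <=
    n%:R * (chi1 Lap * \sum_t dot (x t) (Lap *m x t)).
  rewrite mulrA !mulr_sumr mulr_natl -[X in _ *+ X]card_ord -sumr_const.
  by apply: ler_sum => t _; rewrite -{1}(dot_arc t) -(card_arc t) variance_le_chi1.
rewrite ler_pM2l // => le1.
rewrite mulrBr [_ * n%:R]mulrC -expr2 (le_trans le1) // ler_pM2l //; exact: chi1_gt0.
Qed.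

(** With [h] the integer half of [n], [h * (n - h)] is at least [(n ^ 2 - 1) / 4], hence at least
    [n ^ 2 / 8]. *)
Lemma cycle_chi1_mxtrace_ge_sqr : cycle_graph N ->
  n%:R ^+ 2 <= 8 * (chi1 Lap * \tr Lap).
Proof.
move=> cyc; have [n3 _] := cyc.
have hn : (n./2 <= n)%N by lia.
apply: (@le_trans _ _ (8 * (n./2%:R * (n%:R - n./2%:R)))); last first.
  by rewrite ler_pM2l // cycle_chi1_mxtrace_ge.
rewrite -natrB // -!natrM -natrX ler_nat.
by have := odd_double_half n; move: n3; case: odd; nia.
Qed.

End Cycle.

(** * Communication rates *)

Section Rates.
Variables (R : realType) (N : network R).
Local Notation n := (nodes N).
Local Notation Lap := (laplacian N).
Local Notation T := (\tr Lap).
Local Notation c1 := (chi1 Lap).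
Local Notation c2 := (chi2 (edges N) Lap).
Local Notation "#E" := (edgesR N) (at level 0).

(** The rates involve square roots, so all comparisons are made between squares. The grouping
    [c2 * T] is the quantity controlled by [kappa]. *)
Lemma dadao_rate_sqr :
  (2^-1 * \tr (dadao_gossip N)) ^+ 2 = c1 * (c2 * T) * T / 2.
Proof.
rewrite /dadao_gossip linearZ /= !exprMn sqr_sqrtr; first by field.
by rewrite mulr_ge0 ?chi2_ge0 // mulr_ge0 // ltW // chi1_gt0.
Qed.

(** [X] bounds the trace per node: it will be the operator norm for MSDA and 1 for gradient
    tracking. *)
Lemma dadao_rate_le (X : R) : 0 <= X -> T <= n%:R * X ->
  (2^-1 * \tr (dadao_gossip N)) ^+ 2 <= kappa N * n%:R * #E * (c1 * X).
Proof.
move=> X0 hT; rewrite dadao_rate_sqr.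
have := ler_pM (mulr_ge0 (chi2_ge0 N) (mxtrace_laplacian_ge0 N))
  (mxtrace_laplacian_ge0 N) (chi2_mxtrace_le N) hT.
move=> /(ler_wpM2l (ltW (chi1_gt0 N))) h.
have -> : kappa N * n%:R * #E * (c1 * X) = c1 * (2 * kappa N * #E * (n%:R * X)) / 2.
  by field.
by rewrite ler_pM2r ?invr_gt0 // -mulrA.
Qed.

Lemma dadao_rate_complete_le (X : R) : complete_graph N -> 0 <= X -> T <= n%:R * X ->
  (2^-1 * \tr (dadao_gossip N)) ^+ 2 * n%:R <= 4 * (kappa N * n%:R * #E * (c1 * X)).
Proof.
move=> compl X0 hT; rewrite dadao_rate_sqr.
have := ler_pM (mulr_ge0 (mulr_ge0 (chi2_ge0 N) (mxtrace_laplacian_ge0 N)) (ler0n _ _))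
  (mxtrace_laplacian_ge0 N) (chi2_mxtrace_complete_le compl) hT.
move=> /(ler_wpM2l (ltW (chi1_gt0 N))) h.
have -> : 4 * (kappa N * n%:R * #E * (c1 * X)) = c1 * (8 * kappa N * #E * (n%:R * X)) / 2.
  by field.
have -> : c1 * (c2 * T) * T / 2 * n%:R = c1 * (c2 * T * n%:R * T) / 2 by ring.
by rewrite ler_pM2r ?invr_gt0.
Qed.

Lemma undirectedR_le : undirectedR N <= #E.
Proof. by rewrite ler_nat leq_imset_card. Qed.

Lemma opnorm_laplacian_ge0 : 0 <= opnorm Lap.
Proof.
rewrite -(pmulr_rge0 _ (nodesR_gt0 N)).
exact: le_trans (mxtrace_laplacian_ge0 N) (mxtrace_le_opnorm _).
Qed.

(** * Laplacians admissible for ADOM+ *)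

Section Adom.
Variable chi : R.
Hypothesis valid : adom_valid N chi.

(** Expansion of the square in the validity condition. Dropping the first term on the left bounds
    [chi1]; dropping the second bounds the spectrum by 2. *)
Let defect x : dot x (ones R n) = 0 ->
  dot (Lap *m x) (Lap *m x) + chi^-1 * dot x x <= 2 * dot x (Lap *m x).
Proof.
case: valid => _ /[apply]; rewrite !enorm_sqr !(dotDl, dotDr, dotNl, dotNr).
by rewrite (dotC (Lap *m x) x); lra.
Qed.

Lemma adom_chi_gt0 : 0 < chi. Proof. by case: valid => /(lt_le_trans ltr01). Qed.

Lemma adom_chi1_le : c1 <= 2 * chi.
Proof.
have chi0 := adom_chi_gt0; apply: chi1_le => [|x /enorm1P x1 /defect].
  by rewrite mulr_gt0.
by rewrite x1 invfM; have := dot_ge0 (Lap *m x); lra.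
Qed.

Lemma adom_mxtrace_le : T <= 2 * n%:R.
Proof.
rewrite mxtrace_laplacian_quad mulr_natr -[X in _ *+ X]card_ord -sumr_const.
apply: ler_sum => i _; rewrite -laplacian_quad_center.
set x := center _.
have := defect (dot_center_ones (nodes_gt0 N) (basis_vec R i)); rewrite -/x => h.
have x1 : dot x x <= 1.
  rewrite dot_center ?nodes_gt0 // (enorm1P (enorm_basis_vec R i)) gerBl.
  by rewrite mulr_ge0 ?sqr_ge0 ?invr_ge0 ?ler0n.
have chix : 0 <= chi^-1 * dot x x.
  by rewrite mulr_ge0 ?dot_ge0 // invr_ge0 ltW // adom_chi_gt0.
(* With [q] the energy of [x], the squared norm of [Lap *m x] is at most [2 * q]; nonnegativity here
   then gives [q <= 2 * dot x x <= 2]. *)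
clearbody x; have := dot_ge0 (Lap *m x - 2 *: x).
rewrite !(dotDl, dotDr, dotNl, dotNr, dotZl, dotZr) (dotC (Lap *m x) x).
by lra.
Qed.

Lemma adom_rate_le :
  (2^-1 * \tr (dadao_gossip N)) ^+ 2 <= 8 * n%:R ^+ 2 * chi ^+ 2.
Proof.
have T0 := mxtrace_laplacian_ge0 N; have c10 := chi1_gt0 N.
have T2 : T ^+ 2 <= 4 * n%:R ^+ 2.
  have := ler_pM T0 T0 adom_mxtrace_le adom_mxtrace_le; rewrite -expr2; lra.
have cc : c1 * c2 <= 4 * chi ^+ 2.
  have := ler_pM (ltW c10) (chi2_ge0 N) adom_chi1_le
    (le_trans (chi2_le_chi1 N) adom_chi1_le).
  by lra.
have := ler_pM (mulr_ge0 (ltW c10) (chi2_ge0 N)) (sqr_ge0 _) cc T2.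
by rewrite dadao_rate_sqr; lra.
Qed.

End Adom.

(** * Gossip matrices of the gradient tracking methods *)

Section Tracking.
Variable W : 'M[R]_n.
Hypothesis valid : tracking_valid W.

Lemma tracking_mxtrace_le : T <= n%:R * 1.
Proof.
case: valid => -> _ [W0 _ _] _.
by rewrite mulr1 linearB /= mxtrace1 gerBl sumr_ge0.
Qed.

(** Orthogonally to [ones], [W] acts as [W] minus the averaging matrix, so its quadratic form on
    unit vectors is at most [1 - vartheta W]. *)
Lemma tracking_chi1_le : c1 <= (vartheta W)^-1.
Proof.
case: valid => LW _ _ v0; apply: chi1_le => [|x x1 x_ones]; first by rewrite invr_gt0.
rewrite invrK LW mulmxBl mul1mx dotDr dotNr (enorm1P x1) /vartheta lerD2l lerN2.
have := quad_form_le_opnorm (W - n%:R^-1 *: (ones R n *m (ones R n)^T)) x1.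
suff -> : (W - n%:R^-1 *: (ones R n *m (ones R n)^T)) *m x = W *m x by [].
rewrite mulmxBl -scalemxAl -mulmxA.
suff -> : (ones R n)^T *m x = 0 by rewrite mulmx0 scaler0 subr0.
by apply/matrixP => i j; rewrite !ord1 [RHS]mxE -[LHS]/(dot _ x) dotC.
Qed.

End Tracking.
End Rates.

(** * Comparison along a filter *)

Section Asymptotics.
Variables (R : realType) (I : Type) (F : filter_on I).
Implicit Types f g : I -> R.

Lemma eqO_sqr f g (C : R) :
  (\forall k \near F, f k ^+ 2 <= C * g k ^+ 2) -> f =O_F g.
Proof.
(* This threshold is at least 1 and at least [C], whatever the sign of [C], so any larger [M]
   satisfies [C <= M ^+ 2]. *)
move=> fg; apply/eqOP; exists (C ^+ 2 + 1); split; first exact: num_real.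
move=> M CM; near=> k.
have M0 : 0 <= M by rewrite (le_trans _ (ltW CM)) // addr_ge0 ?sqr_ge0.
rewrite -(ler_pXn2r (ltn0Sn 1)) ?nnegrE ?mulr_ge0 ?normr_ge0 //.
rewrite exprMn !real_normK ?num_real //.
have : f k ^+ 2 <= C * g k ^+ 2 by near: k.
move=> /le_trans; apply; rewrite ler_wpM2r ?sqr_ge0 //.
by have := sqr_ge0 C; have := sqr_ge0 (C - 1); nra.
Unshelve. all: by end_near. Qed.

Lemma eqo_sqr f g (N : I -> nat) (C : R) : N k @[k --> F] --> \oo ->
  (\forall k \near F, f k ^+ 2 * (N k)%:R <= C * g k ^+ 2) -> f =o_F g.
Proof.
move=> N_oo fg; apply/eqoP => e e0; near=> k.
rewrite -(ler_pXn2r (ltn0Sn 1)) ?nnegrE ?mulr_ge0 ?normr_ge0 ?(ltW e0) //.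
rewrite exprMn !real_normK ?num_real //.
(* Once [N k] exceeds [m], it exceeds [C / e ^+ 2], and [e ^+ 2 * N k] absorbs [C]. *)
pose m := (Num.bound `|C / e ^+ 2|).+1.
have e20 : 0 < e ^+ 2 by rewrite exprn_gt0.
have : (m <= N k)%N by near: k; exact: (N_oo _ (nbhs_infty_ge m)).
rewrite -(ler_nat R) => mN.
have N0 : 0 < (N k)%:R :> R by rewrite (lt_le_trans _ mN) // ltr0n.
have CN : C <= e ^+ 2 * (N k)%:R.
  rewrite mulrC -ler_pdivrMr //.
  rewrite (le_trans (ler_norm _)) // (le_trans (ltW (archi_boundP (normr_ge0 _)))) //.
  by rewrite (le_trans _ mN) // ler_nat.
rewrite -(ler_pM2r N0); have : f k ^+ 2 * (N k)%:R <= C * g k ^+ 2 by near: k.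
move=> /le_trans; apply; rewrite mulrAC ler_wpM2r ?sqr_ge0 //.
Unshelve. all: by end_near. Qed.

End Asymptotics.

(** Orders of magnitude are read along a filter on a family of networks and problem constants. A
    better rate is a big-O; a strict gain is a little-o as the number of nodes tends to infinity. *)
Theorem proposition3p9 (R : realType) (I : Type) (F : filter_on I)
    (N : I -> network R) (L mu eps : I -> R)
    (hmu : forall k, 0 < mu k) (hL : forall k, mu k <= L k)
    (heps : forall k, 0 < eps k < 1) :
  let dadao_comm := fun k => dadao_communications (L k) (mu k) (eps k) (N k) in
  let dadao_grad := fun k => dadao_gradients (L k) (mu k) (eps k) (N k) in
  let msda_comm := fun k => msda_communications (L k) (mu k) (eps k) (N k) in
  let cont_grad := fun k => continuized_gradients (L k) (mu k) (eps k) (N k) in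
  let kappa_bounded :=
    (fun k => kappa (N k)) =O_F (fun k => undirectedR (N k) / nodesR (N k)) in
  let growing := nodes (N k) @[k --> F] --> \oo in
  [/\ kappa_bounded ->
        dadao_comm =O_F msda_comm /\
        (growing -> (forall k, complete_graph (N k)) -> dadao_comm =o_F msda_comm),
      forall chi : I -> R, (forall k, adom_valid (N k) (chi k)) ->
        let adom_comm :=
          fun k => adom_communications (L k) (mu k) (eps k) (N k) (chi k) in
        dadao_comm =O_F adom_comm /\
        (growing -> (forall k, complete_graph (N k)) -> dadao_comm =o_F adom_comm),
      kappa_bounded -> forall W : forall k, 'M[R]_(nodes (N k)),
        (forall k, tracking_valid (W k)) ->
        let tracking_comm :=
          fun k => tracking_communications (L k) (mu k) (eps k) (W k) in
        dadao_comm =O_F tracking_comm /\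
        (growing -> (forall k, complete_graph (N k)) ->
           dadao_comm =o_F tracking_comm)
    & (forall k, continuized_valid (N k)) ->
        dadao_grad =O_F cont_grad /\
        (growing -> (forall k, cycle_graph (N k)) ->
           dadao_grad =o_F cont_grad)].
Proof.
move=> dadao_comm dadao_grad msda_comm cont_grad kappa_bounded growing.
pose it k := iterations (L k) (mu k) (eps k).
have dadao_sqr k : dadao_comm k ^+ 2 =
    (2^-1 * \tr (dadao_gossip (N k))) ^+ 2 * it k ^+ 2 by exact: exprMn.
have grad_sqr k : dadao_grad k ^+ 2 = nodesR (N k) ^+ 2 * it k ^+ 2 by exact: exprMn.
(* The hypothesis on [kappa] enters only in this form, since undirected edges are at most as many as
   listed ones. *)
have kappa_edges : kappa_bounded ->
    exists C : R, \forall k \near F, kappa (N k) * nodesR (N k) <= C * edgesR (N k).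
  move=> /eqO_exP[C C0 hC]; exists C; near=> k.
  have n0 := nodesR_gt0 (N k).
  rewrite -ler_pdivlMr // (le_trans (ler_norm _)) //.
  have : `|kappa (N k)| <= C * `|undirectedR (N k) / nodesR (N k)| by near: k.
  move=> /le_trans; apply; rewrite ger0_norm ?divr_ge0 ?ler0n //.
  by rewrite -mulrA ler_pM2l // ler_pM2r ?invr_gt0 // undirectedR_le.
(* Common to MSDA and gradient tracking: [b] is the factor of the competing rate beside the number
   of edges. *)
have comparison (b X : I -> R) :
    kappa_bounded ->
    (forall k, 0 <= X k) -> (forall k, \tr (laplacian (N k)) <= nodesR (N k) * X k) ->
    (forall k, chi1 (laplacian (N k)) * X k <= b k ^+ 2) ->
    dadao_comm =O_F (fun k => edgesR (N k) * b k * it k) /\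
    (growing -> (forall k, complete_graph (N k)) ->
       dadao_comm =o_F (fun k => edgesR (N k) * b k * it k)).
  move=> /kappa_edges[C hC] X0 hT hb.
  have bound k : kappa (N k) * nodesR (N k) <= C * edgesR (N k) ->
      kappa (N k) * nodesR (N k) * edgesR (N k) *
        (chi1 (laplacian (N k)) * X k) * it k ^+ 2 <=
      C * (edgesR (N k) * b k * it k) ^+ 2.
    move=> kC; have -> : C * (edgesR (N k) * b k * it k) ^+ 2 =
      C * edgesR (N k) * edgesR (N k) * b k ^+ 2 * it k ^+ 2 by ring.
    rewrite ler_wpM2r ?sqr_ge0 // ler_pM //.
    - by rewrite mulr_ge0 ?edgesR_ge0 // mulr_ge0 ?kappa_ge0 // ler0n.
    - by rewrite mulr_ge0 // ltW // chi1_gt0.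
    - by rewrite ler_wpM2r ?ler0n.
  split=> [|grow compl].
    apply: (@eqO_sqr _ _ _ _ _ C); near=> k.
    have kC : kappa (N k) * nodesR (N k) <= C * edgesR (N k) by near: k.
    apply: le_trans (bound k kC).
    by rewrite dadao_sqr ler_wpM2r ?sqr_ge0 // dadao_rate_le.
  apply: (@eqo_sqr _ _ _ _ _ (fun k => nodes (N k)) (4 * C)) => //; near=> k.
  have kC : kappa (N k) * nodesR (N k) <= C * edgesR (N k) by near: k.
  rewrite -mulrA; apply: le_trans (ler_wpM2l (ler0n _ 4) (bound k kC)).
  by rewrite dadao_sqr [leLHS]mulrAC [leRHS]mulrA ler_wpM2r ?sqr_ge0 // dadao_rate_complete_le.
split.
(* With [X] the operator norm, [chi1 * X] is exactly [rho]. *)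
- move=> kb; apply: (comparison (fun k => Num.sqrt (rho (laplacian (N k))))
    (fun k => opnorm (laplacian (N k)))) => // k.
  + exact: opnorm_laplacian_ge0.
  + exact: mxtrace_le_opnorm.
  + by rewrite sqr_sqrtr ?mulr_ge0 ?opnorm_laplacian_ge0 ?(ltW (chi1_gt0 _)) // mulrC.
- move=> chi valid adom_comm; split=> [|grow compl].
    (* [32 = 8 * 2 ^ 2], from [n <= 2 * #E]. *)
    apply: (@eqO_sqr _ _ _ _ _ 32); near=> k.
    have -> : 32 * adom_comm k ^+ 2 = 8 * (2 * edgesR (N k)) ^+ 2 * chi k ^+ 2 * it k ^+ 2.
      by rewrite /adom_comm /adom_communications -/(it k); ring.
    rewrite dadao_sqr ler_wpM2r ?sqr_ge0 // (le_trans (adom_rate_le (valid k))) //.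
    rewrite ler_wpM2r ?sqr_ge0 // ler_pM2l // ler_pXn2r ?nnegrE ?mulr_ge0 ?ler0n //.
    exact: nodes_le_edges.
  (* [128 = 8 * 4 ^ 2]: in the complete graph [n ^ 3 <= n ^ 4 <= (4 * #E) ^ 2]. *)
  apply: (@eqo_sqr _ _ _ _ _ (fun k => nodes (N k)) 128) => //; near=> k.
  have -> : 128 * adom_comm k ^+ 2 = 8 * (4 * edgesR (N k)) ^+ 2 * chi k ^+ 2 * it k ^+ 2.
    by rewrite /adom_comm /adom_communications -/(it k); ring.
  rewrite dadao_sqr [leLHS]mulrAC ler_wpM2r ?sqr_ge0 //.
  rewrite (le_trans (ler_wpM2r (ler0n _ _) (adom_rate_le (valid k)))) // [leLHS]mulrAC.
  rewrite ler_wpM2r ?sqr_ge0 // -mulrA ler_pM2l //.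
  have := edges_complete (compl k); have := nodes_gt1 (N k).
  rewrite -(ltr_nat R) => n1 h.
  have : nodesR (N k) ^+ 2 * nodesR (N k) ^+ 2 <= (4 * edgesR (N k)) ^+ 2.
    by rewrite expr2 ler_pM ?sqr_ge0.
  apply: le_trans; rewrite ler_wpM2l ?sqr_ge0 // expr2 ler_peMl ?ler0n // ltW //.
- move=> kb W valid; apply: (comparison
    (fun k => (Num.sqrt (vartheta (W k)))^-1) (fun=> 1)) => // k.
  + exact: tracking_mxtrace_le (valid k).
  + case: (valid k) => _ _ _ /ltW v0.
    by rewrite mulr1 exprVn sqr_sqrtr // tracking_chi1_le.
- move=> valid.
  have cont_sqr k : cont_grad k ^+ 2 =
      chi1 (laplacian (N k)) * chi2 (edges (N k)) (laplacian (N k)) * it k ^+ 2.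
    by rewrite exprMn sqr_sqrtr // mulr_ge0 ?chi2_ge0 // ltW // chi1_gt0.
  (* The trace is 2, so [n - 1 <= 2 * chi1], and [n / 2 <= n - 1]. *)
  have c1_ge k : nodesR (N k) <= 4 * chi1 (laplacian (N k)).
    have := chi1_mxtrace_ge (N k); rewrite valid.
    by have := nodes_gt1 (N k); rewrite -(ler_nat R) /nodesR; lra.
  have c2_ge k : nodesR (N k) <= 4 * chi2 (edges (N k)) (laplacian (N k)).
    have := chi2_mxtrace_ge (N k); rewrite valid.
    by have := nodes_gt1 (N k); rewrite -(ler_nat R) /nodesR; lra.
  split=> [|grow cyc].
    apply: (@eqO_sqr _ _ _ _ _ 16); near=> k; rewrite grad_sqr cont_sqr [leRHS]mulrA.
    rewrite ler_wpM2r ?sqr_ge0 //.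
    have := ler_pM (ler0n _ _) (ler0n _ _) (c1_ge k) (c2_ge k).
    by rewrite -expr2; lra.
  (* In the cycle [n ^ 2 <= 16 * chi1], which with [n <= 4 * chi2] yields 64 and the spare factor
     [n]. *)
  apply: (@eqo_sqr _ _ _ _ _ (fun k => nodes (N k)) 64) => //; near=> k.
  rewrite grad_sqr cont_sqr [leRHS]mulrA [leLHS]mulrAC ler_wpM2r ?sqr_ge0 //.
  have := cycle_chi1_mxtrace_ge_sqr (cyc k); rewrite valid => h.
  have := ler_pM (sqr_ge0 _) (ler0n _ _) h (c2_ge k).
  by rewrite /nodesR; lra.
Unshelve. all: by end_near. Qed.
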